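(* Let $\mathcal{G}$ be a finite game with game map $U:\Delta\to\mathbb{R}^n$, let $\gamma>0$ and $\epsilon>0$, and let $\boldsymbol{\sigma}$ be the overall soft-max choice map with temperature $\epsilon$. Let the players' learning scheme be EXP-D-RL, i.e. $$\dot z(t)=\gamma\big(U(x(t))-z(t)\big),\qquad x(t)=\boldsymbol{\sigma}(z(t)),\qquad t\ge 0,\quad z(0)\in\mathbb{R}^n .$$ Assume that the map $U\circ\boldsymbol{\sigma}:\mathbb{R}^n\to\mathbb{R}^n$ has a finite number of fixed points, all isolated. (i) If $-U$ is monotone on $\Delta$, i.e. $-(x-x')^\top(U(x)-U(x'))\ge 0$ for all $x,x'\in\Delta$, then for any $\epsilon>0$ and any $z(0)\in\mathbb{R}^n$ the scores $z(t)$ converge, as $t\to\infty$, to a rest point $\overline z^\star$ (i.e. $\overline z^\star=U(\boldsymbol{\sigma}(\overline z^\star))$), and the strategies $x(t)=\boldsymbol{\sigma}(z(t))$ converge to a Nash distribution $\overline x^\star=\boldsymbol{\sigma}(\overline z^\star)$ of $\mathcal{G}$. (ii) If $-U$ is $\mu$-hypo-monotone on $\Delta$ for some $\mu>0$, i.e. $-(x-x')^\top(U(x)-U(x'))\ge -\mu\|x-x'\|_2^2$ for all $x,x'\in\Delta$, then the same conclusions hold for any $\epsilon>\mu$.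
   Context: Finite game: there are players $\mathcal{N}=\{1,\dots,N\}$; player $p$ has a finite action set $\mathcal{A}^p=\{1,\dots,n^p\}$ and a payoff function $\mathcal{U}^p:\prod_{q\in\mathcal{N}}\mathcal{A}^q\to\mathbb{R}$. Put $n=\sum_p n^p$. The mixed-strategy set of player $p$ is the simplex $\Delta^p=\{x^p\in\mathbb{R}^{n^p}_{\ge 0}:\ \sum_i x^p_i=1\}$ and $\Delta=\prod_{p}\Delta^p\subset\mathbb{R}^n$. The payoff is extended to $\Delta$ by expectation: $\mathcal{U}^p(x)=\sum_{i_1\in\mathcal{A}^1}\cdots\sum_{i_N\in\mathcal{A}^N}\mathcal{U}^p(i_1,\dots,i_N)\,x^1_{i_1}\cdots x^N_{i_N}$. For $i\in\mathcal{A}^p$, $U^p_i(x)=\mathcal{U}^p(i;x^{-p})$ is the expected payoff of player $p$ when he uses the pure strategy $i$ and the others use $x^{-p}=(x^q)_{q\ne p}$. The payoff vector of player $p$ is $U^p(x)=(U^p_i(x))_{i\in\mathcal{A}^p}\in\mathbb{R}^{n^p}$ and the game map is $U(x)=(U^p(x))_{p\in\mathcal{N}}\in\mathbb{R}^n$. Soft-max: for $\epsilon>0$ and $z^p\in\mathbb{R}^{n^p}$, $\sigma^p(z^p)\in\Delta^p$ has components $\sigma^p_i(z^p)=\exp(z^p_i/\epsilon)\big/\sum_{j\in\mathcal{A}^p}\exp(z^p_j/\epsilon)$. For $z=(z^p)_{p\in\mathcal{N}}\in\mathbb{R}^n$, $\boldsymbol{\sigma}(z)=(\sigma^p(z^p))_{p\in\mathcal{N}}\in\Delta$.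 Nash distribution (logit equilibrium) of $\mathcal{G}$ (with parameter $\epsilon$): a point $\overline x^\star\in\Delta$ with $\overline x^\star=\boldsymbol{\sigma}(U(\overline x^\star))$. *)

(* Defs.v *)
From mathcomp Require Import all_boot all_order all_algebra.
From mathcomp Require Import all_classical all_reals all_analysis.

Set Implicit Arguments.
Unset Strict Implicit.
Unset Printing Implicit Defensive.

Import Order.TTheory GRing.Theory Num.Theory.
Import numFieldNormedType.Exports.

Local Open Scope classical_set_scope.
Local Open Scope ring_scope.

(* Players are 'I_N, player p has the actions 'I_(n p).  A point x of
   R^n = \prod_p R^(n p) is a row vector of width \sum_p n p, whose block of
   player p is submxrow x p; \mxrow_p reassembles the blocks. *)

Section EuclideanSpace.
Variables (R : realType) (m : nat).
Implicit Types x y : 'rV[R]_m.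

Definition dot x y : R := (x *m y^T) 0 0.

(* The library's norm `|x| on 'rV[R]_m is the sup norm. *)
Definition norm2 x : R := Num.sqrt (dot x x).

Definition monotone_on (D : set 'rV[R]_m) (F : 'rV[R]_m -> 'rV[R]_m) : Prop :=
  forall x x', D x -> D x' -> 0 <= dot (x - x') (F x - F x').

Definition hypomonotone_on (mu : R) (D : set 'rV[R]_m)
    (F : 'rV[R]_m -> 'rV[R]_m) : Prop :=
  forall x x', D x -> D x' ->
    - (mu * norm2 (x - x') ^+ 2) <= dot (x - x') (F x - F x').

Definition fixed_points (F : 'rV[R]_m -> 'rV[R]_m) : set 'rV[R]_m :=
  [set z | F z = z].

End EuclideanSpace.

Section Game.
Variables (R : realType) (N : nat) (n : 'I_N -> nat).

Definition action_profile := {dffun forall p : 'I_N, 'I_(n p)}.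

Definition joint_vector := 'rV[R]_(\sum_p n p).

Definition simplex k : set 'rV[R]_k :=
  [set v | (forall i, 0 <= v 0 i) /\ \sum_i v 0 i = 1].

Definition mixed_profiles : set joint_vector :=
  [set x | forall p, simplex (submxrow x p)].

Definition expected_payoff (w : action_profile -> R) (x : joint_vector) : R :=
  \sum_(a : action_profile) w a * \prod_q submxrow x q 0 (a q).

(* (i; x^{-p}): the block of player p is replaced by the pure strategy i. *)
Definition pure_deviation (x : joint_vector) (p : 'I_N) (i : 'I_(n p)) :
    joint_vector :=
  \mxrow_q dfwith (submxrow x) p (delta_mx 0 i) q.

(* The multilinear formula makes the game map total on R^n; only its values
   on mixed_profiles are meaningful. *)
Definition game_map (u : 'I_N -> action_profile -> R) (x : joint_vector) :
    joint_vector :=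
  \mxrow_p \row_(i < n p) expected_payoff (u p) (pure_deviation x i).

Definition softmax (eps : R) k (v : 'rV[R]_k) : 'rV[R]_k :=
  \row_i (expR (v 0 i / eps) / \sum_j expR (v 0 j / eps)).

Definition joint_softmax (eps : R) (z : joint_vector) : joint_vector :=
  \mxrow_p softmax eps (submxrow z p).

Definition nash_distribution (u : 'I_N -> action_profile -> R) (eps : R)
    (x : joint_vector) : Prop :=
  mixed_profiles x /\ x = joint_softmax eps (game_map u x).

(* Only times t >= 0 are constrained.  The derivative of z at t is taken along
   increments h such that t + h >= 0: it is the usual two-sided derivative for
   t > 0 and the right derivative for t = 0. *)
Definition exp_d_rl (u : 'I_N -> action_profile -> R) (gamma eps : R)
    (z x : R -> joint_vector) : Prop :=
  forall t, 0 <= t ->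
    (h^-1 *: (z (t + h) - z t) @[h --> within [set h | 0 <= t + h] 0^'] -->
       gamma *: (game_map u (x t) - z t)) /\
    x t = joint_softmax eps (z t).

Definition converges_to_nash_distribution
    (u : 'I_N -> action_profile -> R) (eps : R)
    (z x : R -> joint_vector) : Prop :=
  exists zstar : joint_vector,
    [/\ zstar = game_map u (joint_softmax eps zstar),
        z t @[t --> +oo] --> zstar,
        nash_distribution u eps (joint_softmax eps zstar) &
        x t @[t --> +oo] --> joint_softmax eps zstar].

End Game.

(* Main.v *)
(* Write x = sigma(z), let a be a Nash distribution and mu < eps (mu = 0 in the
   monotone case).  Up to a block-constant normalisation z / eps is ln x, so
   that, for the rest point U(a), eps times the Kullback-Leibler divergence
   V = KL(a || x) is the Bregman divergence of log-sum-exp and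
   V' = (x - a).(z' / eps).  With D = (x - a).(ln x - ln a) one has V <= D and
   |x - a|^2 <= D, hence
   V' <= - gamma (1 - mu / eps) D <= - gamma (1 - mu / eps) V.
   Thus V decays exponentially.  Since V bounds |x - a|^2 / 4, x tends to a
   exponentially fast, and the linear equation z' = gamma (U(x) - z) forces z
   to tend to U(a).

   Existence of a needs no Brouwer theorem: put y(x) = sigma(U(x)) and minimise
   KL(x || y(x)) over the compact set of mixed profiles with all entries at
   least d > 0, where d is small enough for this set to be stable under y.  At
   a minimiser x the derivative in the direction v = y(x) - x is at most
   (mu / eps - 1) |v|^2, so v = 0. *)
Require Import Defs.
From mathcomp Require Import all_boot all_order all_algebra.
From mathcomp Require Import all_classical all_reals all_analysis.
From mathcomp Require Import ring lra.

Set Implicit Arguments.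
Unset Strict Implicit.
Unset Printing Implicit Defensive.

Import Order.TTheory GRing.Theory Num.Theory.
Import numFieldNormedType.Exports.

Local Open Scope classical_set_scope.
Local Open Scope ring_scope.

(** * Scalar inequalities for the logarithm *)

Section EntropyInequalities.
Variable R : realType.
Implicit Types a b : R.

(** This is the tangent bound [ln s <= s - 1] at [s = b / a], multiplied by [- a]. *)
Lemma ln_sub_ge a b : 0 < a -> 0 < b -> a - b <= a * (ln a - ln b).
Proof.
move=> a0 b0; have ba0 : 0 < b / a by rewrite divr_gt0.
have : ln (b / a) <= b / a - 1.
  by have := @le_ln1Dx R (b / a - 1); rewrite [1 + _]addrC subrK; apply; lra.
rewrite ln_div ?posrE// => h.
have -> : a - b = - (a * (b / a - 1)) by field; rewrite gt_eqF.
by rewrite -[ln a - ln b]opprB mulrN lerN2 ler_pM2l.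
Qed.

(* With p = sqrt a and q = sqrt b this is (p - q)^2 (p + q)^2 <= 4 (p - q)^2:
   the Hellinger distance bounds the Kullback-Leibler divergence from below. *)
Lemma ln_sub_ge_sqr a b : 0 < a <= 1 -> 0 < b <= 1 ->
  a - b + (a - b) ^+ 2 / 4 <= a * (ln a - ln b).
Proof.
move=> /andP[a0 a1] /andP[b0 b1].
have [p0 q0] : 0 < Num.sqrt a /\ 0 < Num.sqrt b by rewrite !sqrtr_gt0.
have [ea eb] : a = Num.sqrt a ^+ 2 /\ b = Num.sqrt b ^+ 2.
  by rewrite !sqr_sqrtr// ltW.
move: (Num.sqrt a) (Num.sqrt b) p0 q0 ea eb => p q p0 q0 ea eb.
have p1 : p <= 1 by nra.
have q1 : q <= 1 by nra.
have -> : ln a - ln b = 2 * (ln p - ln q).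
  by rewrite ea eb !lnXn// mulr2n; lra.
have h := ler_wpM2l (ltW p0) (ln_sub_ge p0 q0).
rewrite {1}ea.
have : (p + q) ^+ 2 <= 4 by nra.
move=> /(ler_wpM2l (sqr_ge0 (p - q))); rewrite ea eb; nra.
Qed.

(** On []0, 1]] the logarithm has slope at least 1: for [b <= a], [ln_sub_ge] gives [a * (ln a - ln
    b) >= a - b >= a * (a - b)]. *)
Lemma sqr_sub_le_mul_ln a b : 0 < a <= 1 -> 0 < b <= 1 ->
  (a - b) ^+ 2 <= (a - b) * (ln a - ln b).
Proof.
wlog ab : a b / b <= a.
  move=> wl ha hb; have [/wl|/ltW/wl] := leP b a; first exact.
  by rewrite -[X in _ -> X ^+ 2 <= _]opprB; nra.
move=> /andP[a0 a1] /andP[b0 b1]; rewrite expr2 ler_wpM2l ?subr_ge0//.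
rewrite -(ler_pM2l a0); apply: le_trans (ln_sub_ge a0 b0).
by rewrite ler_piMl// subr_ge0.
Qed.

End EntropyInequalities.

(** * Mixed profiles, Kullback-Leibler divergence and soft-max *)

Section Profiles.
Variables (R : realType) (N : nat) (n : 'I_N -> nat).
Implicit Types a b x z : joint_vector R n.

Local Notation sig1 k := (tagnat.sig1 k).
Local Notation sig2 k := (tagnat.sig2 k).
Local Notation Rank p i := (tagnat.Rank p i).

Lemma dotE m (x y : 'rV[R]_m) : dot x y = \sum_k x 0 k * y 0 k.
Proof. by rewrite /dot mxE; apply: eq_bigr => k _; rewrite mxE. Qed.

Lemma norm2_sqr m (x : 'rV[R]_m) : norm2 x ^+ 2 = \sum_k x 0 k ^+ 2.
Proof.
by rewrite sqr_sqrtr dotE ?sumr_ge0// => k _; rewrite -expr2 ?sqr_ge0.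
Qed.

Lemma sum_joint (f : 'I_(\sum_p n p) -> R) :
  \sum_k f k = \sum_p \sum_(i < n p) f (Rank p i).
Proof.
rewrite sig_big_dep/= (reindex (@tagnat.rank N n))/=; last first.
  exact/onW_bij/tagnat.rank_bij.
by apply: eq_bigr => k _; rewrite tagnat.rankE.
Qed.

Lemma mixed_profilesP x :
  mixed_profiles x <->
  (forall k, 0 <= x 0 k) /\ (forall p, \sum_(i < n p) x 0 (Rank p i) = 1).
Proof.
split=> [mx|[x0 x1] p].
  split=> [k|p].
    rewrite -[k]tagnat.sig2K.
    by have [/(_ (sig2 k))] := mx (sig1 k); rewrite mxE.
  by have [_ <-] := mx p; apply: eq_bigr => i _; rewrite mxE.
split=> [i|]; first by rewrite mxE.
by rewrite -[RHS](x1 p); apply: eq_bigr => i _; rewrite mxE.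
Qed.

Lemma mixed_le1 x k : mixed_profiles x -> x 0 k <= 1.
Proof.
move=> /mixed_profilesP[x0 /(_ (sig1 k)) <-].
by rewrite (bigD1 (sig2 k))//= tagnat.sig2K lerDl sumr_ge0.
Qed.

(** Each block of [x] has mass 1. The right-hand side does not depend on [x], so block-constant
    terms cancel between two mixed profiles. *)
Lemma mixed_sum_sig1 x (c : 'I_N -> R) : mixed_profiles x ->
  \sum_k x 0 k * c (sig1 k) = \sum_p c p.
Proof.
move=> /mixed_profilesP[_ x1]; rewrite sum_joint; apply: eq_bigr => p _.
rewrite -[RHS]mul1r -(x1 p) mulr_suml; apply: eq_bigr => i _.
by rewrite tagnat.Rank1K.
Qed.

Lemma mixed_sum x : mixed_profiles x -> \sum_k x 0 k = N%:R.
Proof.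
move=> mx; have := mixed_sum_sig1 (fun=> 1) mx.
rewrite sumr_const card_ord => <-.
by apply: eq_bigr => k _; rewrite mulr1.
Qed.

Definition interior_profiles : set (joint_vector R n) :=
  [set x | mixed_profiles x /\ forall k, 0 < x 0 k].

(** The sum over the players of the Kullback-Leibler divergences of their blocks; it is used for
    interior profiles, where every logarithm is genuine. *)
Definition kl a b : R := \sum_k a 0 k * (ln (a 0 k) - ln (b 0 k)).

Lemma interior_itv x k : interior_profiles x -> 0 < x 0 k <= 1.
Proof. by move=> [mx x0]; rewrite x0 mixed_le1. Qed.

(** A weak form of Pinsker's inequality: when [ln_sub_ge_sqr] is summed, the linear terms
    [a 0 k - b 0 k] cancel because both profiles have total mass [N]. *)
Lemma kl_ge_sqr a b : interior_profiles a -> interior_profiles b ->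
  \sum_k (a 0 k - b 0 k) ^+ 2 / 4 <= kl a b.
Proof.
move=> ia ib.
have -> : \sum_k (a 0 k - b 0 k) ^+ 2 / 4 =
    \sum_k (a 0 k - b 0 k + (a 0 k - b 0 k) ^+ 2 / 4).
  by rewrite big_split/= sumrB (mixed_sum ia.1) (mixed_sum ib.1) subrr add0r.
apply: ler_sum => k _.
by apply: ln_sub_ge_sqr; exact: interior_itv.
Qed.

Lemma kl_ge0 a b : interior_profiles a -> interior_profiles b -> 0 <= kl a b.
Proof.
move=> ia ib; apply: le_trans (kl_ge_sqr ia ib).
by apply: sumr_ge0 => k _; rewrite divr_ge0 ?sqr_ge0.
Qed.

Lemma norm2_le_kl a b : interior_profiles a -> interior_profiles b ->
  norm2 (a - b) ^+ 2 <= \sum_k (a 0 k - b 0 k) * (ln (a 0 k) - ln (b 0 k)).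
Proof.
move=> ia ib; rewrite norm2_sqr; apply: ler_sum => k _; rewrite !mxE.
by apply: sqr_sub_le_mul_ln; exact: interior_itv.
Qed.

(** The right-hand side is the symmetrised divergence [kl a b + kl b a], and [kl b a] is
    nonnegative. *)
Lemma kl_le a b : interior_profiles a -> interior_profiles b ->
  kl a b <= \sum_k (a 0 k - b 0 k) * (ln (a 0 k) - ln (b 0 k)).
Proof.
move=> ia ib; rewrite -subr_ge0 -sumrB; apply: le_trans (kl_ge0 ib ia) _.
by rewrite le_eqVlt; apply/orP; left; apply/eqP; apply: eq_bigr => k _; ring.
Qed.

Definition partition_function eps z p : R :=
  \sum_(i < n p) expR (z 0 (Rank p i) / eps).

Lemma joint_softmaxE eps z k :
  joint_softmax eps z 0 k =
  expR (z 0 k / eps) / partition_function eps z (sig1 k).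
Proof.
rewrite !mxE tagnat.sig2K; congr (_ / _).
by apply: eq_bigr => i _; rewrite mxE.
Qed.

Hypothesis n_gt0 : forall p, (0 < n p)%N.

Lemma partition_function_gt0 eps z p : 0 < partition_function eps z p.
Proof.
rewrite /partition_function (bigD1 (Ordinal (n_gt0 p)))//=.
by rewrite ltr_wpDr ?expR_gt0// sumr_ge0// => i _; rewrite expR_ge0.
Qed.

Lemma joint_softmax_interior eps z : interior_profiles (joint_softmax eps z).
Proof.
have gt0 k : 0 < joint_softmax eps z 0 k.
  by rewrite joint_softmaxE divr_gt0 ?expR_gt0 ?partition_function_gt0.
split=> //; apply/mixed_profilesP; split=> [k|p]; first exact: ltW.
have /gt_eqF Z0 := partition_function_gt0 eps z p.
rewrite -[RHS](divff (negbT Z0)) mulr_suml; apply: eq_bigr => i _.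
by rewrite joint_softmaxE tagnat.Rank1K.
Qed.

Lemma ln_joint_softmax eps z k :
  ln (joint_softmax eps z 0 k) =
  z 0 k / eps - ln (partition_function eps z (sig1 k)).
Proof.
rewrite joint_softmaxE ln_div ?posrE ?expR_gt0 ?partition_function_gt0//.
by rewrite expRK.
Qed.

(* The normalising constants of the soft-max are constant on each block, and
   are thus annihilated by differences of mixed profiles. *)
Lemma sum_sub_mul_ln_softmax eps z z' a b :
  mixed_profiles a -> mixed_profiles b ->
  \sum_k (a 0 k - b 0 k) *
    (ln (joint_softmax eps z 0 k) - ln (joint_softmax eps z' 0 k)) =
  dot (a - b) (z - z') / eps.
Proof.
move=> ma mb.
pose c p := ln (partition_function eps z' p) - ln (partition_function eps z p).
transitivity (dot (a - b) (z - z') / eps +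
    \sum_k (a 0 k * c (sig1 k) - b 0 k * c (sig1 k))).
  rewrite dotE mulr_suml -big_split/=; apply: eq_bigr => k _.
  by rewrite !ln_joint_softmax !mxE /c; ring.
by rewrite sumrB !mixed_sum_sig1// subrr addr0.
Qed.

End Profiles.

(** * Coordinatewise limits, sums and products *)

Section RowVectorLimits.
Variable R : realType.

Lemma cvg_rV (T : Type) (F : set_system T) {FF : Filter F} m
    (f : T -> 'rV[R]_m) (l : 'rV[R]_m) :
  (forall k, f t 0 k @[t --> F] --> l 0 k) -> f t @[t --> F] --> l.
Proof.
move=> fl; apply/cvgrPdist_lt => e e0.
have : \forall t \near F, forall k, `|l 0 k - f t 0 k| < e.
  by apply: filter_forall => k; move/cvgrPdist_lt : (fl k); apply.
apply: filterS => t lft; rewrite [ltLHS]mx_normrE.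
by apply: bigmax_lt => // -[i k] _ /=; rewrite !mxE ord1.
Qed.

Lemma cvg_coord (T : Type) (F : set_system T) {FF : Filter F} m
    [f : T -> 'rV[R]_m] [l : 'rV[R]_m] k :
  f t @[t --> F] --> l -> f t 0 k @[t --> F] --> l 0 k.
Proof.
move=> fl; apply: (@cvg_comp _ _ _ f (fun v : 'rV[R]_m => v 0 k) _ _ _ fl).
exact: coord_continuous.
Qed.

Lemma cvg_sumr (T : Type) (F : set_system T) {FF : Filter F} (I : finType)
    (f : I -> T -> R) (l : I -> R) :
  (forall i, f i t @[t --> F] --> l i) ->
  \sum_i f i t @[t --> F] --> \sum_i l i.
Proof. by move=> fl; apply: cvg_big => //; exact: add_continuous. Qed.

Lemma cvg_prodr (T : Type) (F : set_system T) {FF : Filter F} (I : finType)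
    (f : I -> T -> R) (l : I -> R) :
  (forall i, f i t @[t --> F] --> l i) ->
  \prod_i f i t @[t --> F] --> \prod_i l i.
Proof. by move=> fl; apply: cvg_big => //; exact: mul_continuous. Qed.

End RowVectorLimits.

(** * Bounds and continuity of the game map and of the soft-max *)

Section GameMap.
Variables (R : realType) (N : nat) (n : 'I_N -> nat).
Variable u : 'I_N -> action_profile n -> R.
Implicit Types x y z : joint_vector R n.

(** The factors are exchanged one at a time. The induction also carries that both partial products
    stay in [[0, 1]], so that each exchange costs at most [|f i - g i|]. *)
Lemma norm_prod_sub_le (I : finType) (f g : I -> R) :
  (forall i, 0 <= f i <= 1) -> (forall i, 0 <= g i <= 1) ->
  `|\prod_i f i - \prod_i g i| <= \sum_i `|f i - g i|.
Proof.
move=> f01 g01.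
suff [] : [/\ 0 <= \prod_i f i <= 1, 0 <= \prod_i g i <= 1 &
  `|\prod_i f i - \prod_i g i| <= \sum_i `|f i - g i|] by [].
elim/big_rec3 : _ => [|i s q p _ [p01 q01 pq]].
  by rewrite subrr normr0 ler01 lexx.
have fi := f01 i; have gi := g01 i; split; [nra|nra|].
have -> : f i * p - g i * q = (f i - g i) * p + g i * (p - q) by ring.
apply: le_trans (ler_normD _ _) _; rewrite !normrM.
have [p0 p1] := andP p01; have [g0 g1] := andP gi.
rewrite (ger0_norm p0) (ger0_norm g0) lerD// ?ler_piMr//.
by apply: le_trans pq; rewrite ler_piMl.
Qed.

(** A coordinate of a deviation is either copied from [x] or independent of [x]; bounds, Lipschitz
    estimates and limits all reduce to these two cases. *)
Lemma pure_deviation_coord p (i : 'I_(n p)) k :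
  (forall x, pure_deviation x i 0 k = x 0 k) \/
  exists2 c : R, 0 <= c <= 1 & forall x, pure_deviation x i 0 k = c.
Proof.
have [e|pk] := eqVneq p (tagnat.sig1 k); last first.
  by left=> x; rewrite mxE dfwithout// mxE tagnat.sig2K.
right; subst p; exists ((delta_mx 0 i : 'rV[R]__) 0 (tagnat.sig2 k)) => [|x].
  by rewrite mxE ler0n lern1 leq_b1.
by rewrite mxE dfwithin.
Qed.

Lemma expected_payoffE w x :
  expected_payoff w x =
  \sum_(a : action_profile n) w a * \prod_q x 0 (tagnat.Rank q (a q)).
Proof.
apply: eq_bigr => a _; congr (_ * _); apply: eq_bigr => q _.
by rewrite mxE.
Qed.

(** A crude constant that serves twice on mixed profiles: as a bound on every entry of the game map
    and as its Lipschitz constant for the l1 distance. *)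
Definition payoff_bound : R := \sum_p \sum_a `|u p a|.

Lemma sum_payoff_le p : \sum_a `|u p a| <= payoff_bound.
Proof.
by rewrite /payoff_bound (bigD1 p)//= lerDl; do 2!apply: sumr_ge0 => ? _.
Qed.

Lemma payoff_bound_ge0 : 0 <= payoff_bound.
Proof. by do 2!apply: sumr_ge0 => ? _. Qed.

Lemma mixed_itv x k : mixed_profiles x -> 0 <= x 0 k <= 1.
Proof.
by move=> mx; rewrite mixed_le1// andbT; have /mixed_profilesP[->] := mx.
Qed.

Lemma pure_deviation_itv x p (i : 'I_(n p)) k :
  mixed_profiles x -> 0 <= pure_deviation x i 0 k <= 1.
Proof.
move=> mx; have [->|[c c01 ->//]] := pure_deviation_coord i k.
exact: mixed_itv.
Qed.

Lemma game_map_bound x k : mixed_profiles x ->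
  `|game_map u x 0 k| <= payoff_bound.
Proof.
move=> mx; rewrite !mxE expected_payoffE.
apply: le_trans (sum_payoff_le (tagnat.sig1 k)).
apply: le_trans (ler_norm_sum _ _ _) _; apply: ler_sum => a _.
rewrite normrM ler_piMr// normr_prod.
apply: (@le_trans _ _ (\prod_(q < N) 1)); last by rewrite big1_eq.
apply: ler_prod => q _; rewrite normr_ge0/=.
by rewrite ger0_norm; have /andP[] :=
  pure_deviation_itv (tagnat.sig2 k) (tagnat.Rank q (a q)) mx.
Qed.

Lemma game_map_lipschitz x y k : mixed_profiles x -> mixed_profiles y ->
  `|game_map u x 0 k - game_map u y 0 k| <=
  payoff_bound * \sum_j `|x 0 j - y 0 j|.
Proof.
move=> mx my; rewrite !mxE !expected_payoffE -sumrB.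
apply: le_trans (ler_norm_sum _ _ _) _.
apply: le_trans (ler_wpM2r _ (sum_payoff_le (tagnat.sig1 k))); last first.
  exact: sumr_ge0.
rewrite mulr_suml; apply: ler_sum => a _.
rewrite -mulrBr normrM ler_wpM2l//.
apply: le_trans (norm_prod_sub_le _ _) _ => [q|q|].
- exact: pure_deviation_itv.
- exact: pure_deviation_itv.
rewrite sum_joint; apply: ler_sum => q _.
(* Block [q] enters the product only through the action [a q]; the rest of its l1 distance is
   nonnegative and is discarded. *)
rewrite (bigD1 (a q))//= -[leLHS]addr0 lerD ?sumr_ge0//.
have [h|[c _ h]] := pure_deviation_coord (tagnat.sig2 k) (tagnat.Rank q (a q)).
  by rewrite !h.
by rewrite !h subrr normr0.
Qed.

Lemma cvg_game_map (T : Type) (F : set_system T) {FF : Filter F}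
    (f : T -> joint_vector R n) x :
  f t @[t --> F] --> x -> game_map u (f t) @[t --> F] --> game_map u x.
Proof.
move=> fx; apply: cvg_rV => k.
under eq_fun do rewrite !mxE expected_payoffE.
rewrite !mxE expected_payoffE.
apply: cvg_sumr => a; apply: cvgM; [exact: cvg_cst|apply: cvg_prodr] => q.
have [h|[c _ h]] := pure_deviation_coord (tagnat.sig2 k) (tagnat.Rank q (a q)).
  by under eq_fun do rewrite h; rewrite h; exact: cvg_coord.
by under eq_fun do rewrite h; rewrite h; exact: cvg_cst.
Qed.

Hypothesis n_gt0 : forall p, (0 < n p)%N.

Lemma cvg_joint_softmax eps (T : Type) (F : set_system T) {FF : Filter F}
    (f : T -> joint_vector R n) z :
  f t @[t --> F] --> z ->
  joint_softmax eps (f t) @[t --> F] --> joint_softmax eps z.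
Proof.
move=> fz; apply: cvg_rV => k.
have ez j : expR (f t 0 j / eps) @[t --> F] --> expR (z 0 j / eps).
  apply: continuous_cvg; first exact: continuous_expR.
  by apply: cvgM; [exact: cvg_coord|exact: cvg_cst].
under eq_fun do rewrite joint_softmaxE.
rewrite joint_softmaxE; apply: cvgM => //.
apply: cvgV; first by rewrite gt_eqF ?partition_function_gt0.
exact: cvg_sumr.
Qed.

Lemma joint_softmax_lb eps M : 0 < eps ->
  exists2 d : R, 0 < d & forall z k, (forall j, `|z 0 j| <= M) ->
    d <= joint_softmax eps z 0 k.
Proof.
(* Summing over all blocks makes [S] dominate every partition function at once, so that [d] depends
   neither on [k] nor on [z]; the [1 +] gives positivity directly. *)
move=> eps0; pose S := 1 + \sum_(p < N) \sum_(i < n p) expR (M / eps).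
have S0 : 0 < S.
  by rewrite ltr_wpDr ?ltr01//; do 2!apply: sumr_ge0 => ? _; exact: expR_ge0.
exists (expR (- M / eps) / S) => [|z k zM]; first by rewrite divr_gt0 ?expR_gt0.
rewrite joint_softmaxE.
have zP := partition_function_gt0 n_gt0 eps z (tagnat.sig1 k).
apply: ler_pM; rewrite ?expR_ge0 ?invr_ge0 ?(ltW S0)//.
  rewrite ler_expR ler_pM2r ?invr_gt0//.
  by have := zM k; rewrite ler_norml => /andP[].
rewrite lef_pV2 ?posrE// -[leLHS]add0r lerD//.
apply: (@le_trans _ _ (\sum_(i < n (tagnat.sig1 k)) expR (M / eps))).
  apply: ler_sum => i _; rewrite ler_expR ler_pM2r ?invr_gt0//.
  by have := zM (tagnat.Rank (tagnat.sig1 k) i); rewrite ler_norml => /andP[].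
rewrite [leRHS](bigD1 (tagnat.sig1 k))//= lerDl.
by do 2!apply: sumr_ge0 => ? _; rewrite expR_ge0.
Qed.

End GameMap.

(** * Existence of a Nash distribution by minimisation *)

Section Existence.
Variables (R : realType) (N : nat) (n : 'I_N -> nat).
Variable u : 'I_N -> action_profile n -> R.
Hypothesis n_gt0 : forall p, (0 < n p)%N.
Implicit Types x y z : joint_vector R n.

(** The gap between the two sides is exactly [kl x x' + kl y' y], where [y] and [y'] are the
    soft-max of [z] and [z']. This finite-difference bound replaces a differentiation of the
    objective in the minimisation. *)
Lemma kl_softmax_sub_le eps z z' x x' :
  interior_profiles x -> interior_profiles x' ->
  kl x' (joint_softmax eps z') - kl x (joint_softmax eps z) <=
  \sum_k (x' 0 k - x 0 k) * (ln (x' 0 k) - ln (joint_softmax eps z 0 k)) +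
  dot (joint_softmax eps z' - x') (z' - z) / eps.
Proof.
move=> ix ix'.
have iy := joint_softmax_interior n_gt0 eps z.
have iy' := joint_softmax_interior n_gt0 eps z'.
rewrite -(sum_sub_mul_ln_softmax n_gt0 eps z' z iy'.1 ix'.1) -subr_ge0.
apply: le_trans (addr_ge0 (kl_ge0 ix ix') (kl_ge0 iy' iy)) _.
rewrite le_eqVlt; apply/orP; left; apply/eqP.
rewrite /kl -!sumrB -!big_split/= -sumrB.
by apply: eq_bigr => k _; ring.
Qed.

Lemma compact_mixed_lb d :
  compact [set x : joint_vector R n | mixed_profiles x /\ forall k, d <= x 0 k].
Proof.
(* The second interval matters for negative [d]: membership in [A] must still entail nonnegative
   entries. *)
pose A : set (joint_vector R n) :=
  [set x | forall k, `[d, 1]%classic (x ord0 k) /\ `[0, 1]%classic (x ord0 k)].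
pose B : set (joint_vector R n) :=
  \bigcap_p [set x | \sum_(i < n p) x 0 (tagnat.Rank p i) = 1].
have -> : [set x : joint_vector R n |
    mixed_profiles x /\ forall k, d <= x 0 k] = A `&` B.
  apply/seteqP; split=> x.
    move=> [mx xd]; split=> [k|p _]; last first.
      by case/mixed_profilesP : mx => _ /(_ p).
    by have := mixed_itv k mx; have := xd k; rewrite /= !in_itv/=; lra.
  move=> [xA xB]; split=> [|k].
    apply/mixed_profilesP; split=> [k|p]; last exact: xB.
    by have [_] := xA k; rewrite /= in_itv/= => /andP[].
  by have [] := xA k; rewrite /= in_itv/= => /andP[].
apply: compact_closedI.
  have cI : compact ((`[d, 1] : set R) `&` (`[0, 1] : set R)).
    by apply: compact_closedI; [exact: segment_compact|exact: itv_closed].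
  exact: (@rV_compact R _ (fun=> `[d, 1]%classic `&` `[0, 1]%classic)
    (fun=> cI)).
apply: closed_bigI => p _.
apply: (@preimage_closed _ _
  (fun x : joint_vector R n => \sum_(i < n p) x 0 (tagnat.Rank p i) : R)
  [set 1]);
  last exact: closed_eq.
by move=> x _; apply: (cvg_sumr (F := nbhs x)) => i; exact: coord_continuous.
Qed.

Lemma nash_distribution_exists mu eps : 0 < eps -> mu < eps ->
  hypomonotone_on mu (@mixed_profiles R N n) (fun x => - game_map u x) ->
  exists x, interior_profiles x /\ x = joint_softmax eps (game_map u x).
Proof.
move=> eps0 mu_eps Umu.
pose y x := joint_softmax eps (game_map u x).
have yi x : interior_profiles (y x) by exact: joint_softmax_interior.
(* Payoffs are bounded on mixed profiles, so [y] sends all of them into a single set [K] away from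
   the boundary, where the logarithms are continuous. *)
have [d d0 yd] := joint_softmax_lb n_gt0 (payoff_bound u) eps0.
pose K : set (joint_vector R n) :=
  [set x : joint_vector R n | mixed_profiles x /\ forall k, d <= x 0 k].
have yK x : mixed_profiles x -> K (y x).
  move=> mx; split=> [|k]; first exact: (yi x).1.
  by apply: yd => j; exact: game_map_bound.
have Ki x : K x -> interior_profiles x.
  by move=> [mx xd]; split=> // k; exact: lt_le_trans (xd k).
have cvg_y (T : Type) (F : set_system T) (FF : Filter F) f x :
    f t @[t --> F] --> x -> y (f t) @[t --> F] --> y x.
  by move=> fx; apply: cvg_joint_softmax => //; exact: cvg_game_map.
have cvg_ln (T : Type) (F : set_system T) (FF : Filter F)
    (f : T -> joint_vector R n) x k : interior_profiles x ->
    f t @[t --> F] --> x -> ln (f t 0 k) @[t --> F] --> ln (x 0 k).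
  move=> [_ x0] fx; 
  apply: (@cvg_comp _ _ _ (fun t => f t 0 k) (@ln R) _ _ _ (cvg_coord fx)).
  exact: continuous_ln.
have [x /set_mem Kx xmin] : exists2 x, x \in K &
    forall x', x' \in K -> kl x (y x) <= kl x' (y x').
  apply: EVT_min_rV.
  - by exists (y (y 0)); exact/yK/(yi 0).1.
  - exact: compact_mixed_lb.
  - apply: continuous_in_subspaceT => x /set_mem /Ki ix.
    have xx : x' @[x' --> x] --> x by exact: cvg_id.
    apply: (cvg_sumr (F := nbhs x)) => k; apply: cvgM; first exact: cvg_coord.
    apply: cvgB; first exact: cvg_ln.
    by apply: cvg_ln => //; exact: cvg_y.
have ix := Ki _ Kx.
exists x; split=> //.
pose v := y x - x.
pose c s := x + s *: v.
have Kc s : 0 < s <= 1 -> K (c s).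
  move=> s01; have [my yd'] := yK _ Kx.1; split=> [|k]; last first.
    by have := Kx.2 k; have := yd' k; rewrite !mxE; nra.
  have /mixed_profilesP[x0 x1] := Kx.1; have /mixed_profilesP[y0 y1] := my.
  apply/mixed_profilesP; split=> [k|p].
    by have := x0 k; have := y0 k; rewrite !mxE; nra.
  transitivity ((1 - s) * \sum_(i < n p) x 0 (tagnat.Rank p i) +
                s * \sum_(i < n p) y x 0 (tagnat.Rank p i)).
    rewrite !mulr_sumr -big_split/=; apply: eq_bigr => i _.
    by rewrite !mxE; ring.
  by rewrite x1 y1; ring.
(* [s * B s] bounds the increase of the objective from [x] to [c s]. Its terms are the entropy
   slope, the hypo-monotonicity bound on the pairing of [v] with the payoff change, and the error
   from replacing [y (c s) - c s] by [v], which vanishes as [s] tends to 0. *)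
pose B s := \sum_k v 0 k * (ln (c s 0 k) - ln (y x 0 k)) +
  (mu * norm2 v ^+ 2 + payoff_bound u * (\sum_k `|v 0 k|) *
    (\sum_k `|y (c s) 0 k - c s 0 k - v 0 k|)) / eps.
have B_ge0 s : 0 < s <= 1 -> 0 <= B s.
  move=> s01; have s0 : 0 < s by case/andP: s01.
  rewrite -(pmulr_rge0 _ s0).
  have kl_le := kl_softmax_sub_le eps (game_map u x) (game_map u (c s)) ix
    (Ki _ (Kc s s01)).
  have := xmin _ (mem_set (Kc s s01)); rewrite -subr_ge0 => kl_ge.
  apply: le_trans (le_trans kl_ge kl_le) _.
  rewrite mulrDr lerD//.
    rewrite mulr_sumr le_eqVlt; apply/orP; left; apply/eqP.
    by apply: eq_bigr => k _; rewrite !mxE; ring.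
  rewrite mulrA ler_pM2r ?invr_gt0// mulrDr.
  pose D := game_map u (c s) - game_map u x.
  have -> : dot (y (c s) - c s) D = dot v D + dot (y (c s) - c s - v) D.
    by rewrite !dotE -big_split/=; apply: eq_bigr => k _; rewrite !mxE; ring.
  rewrite lerD//.
    have := Umu (c s) x (Kc s s01).1 Kx.1.
    have -> : c s - x = s *: v by rewrite /c addrC addKr.
    have -> : dot (s *: v) (- game_map u (c s) - - game_map u x) =
        - (s * dot v D).
      rewrite !dotE mulr_sumr -sumrN.
      by apply: eq_bigr => k _; rewrite !mxE; ring.
    have -> : norm2 (s *: v) ^+ 2 = s * (s * norm2 v ^+ 2).
      rewrite !norm2_sqr !mulr_sumr; apply: eq_bigr => k _; rewrite !mxE; ring.
    by rewrite lerN2 mulrCA ler_pM2l// mulrCA.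
  rewrite dotE mulr_sumr mulr_sumr; apply: ler_sum => k _.
  apply: le_trans (ler_norm _) _; rewrite normrM mulrC mulrA.
  have -> : (y (c s) - c s - v) 0 k = y (c s) 0 k - c s 0 k - v 0 k.
    by rewrite !mxE.
  apply: ler_wpM2r => //.
  have := game_map_lipschitz u k (Kc s s01).1 Kx.1.
  have -> : \sum_j `|c s 0 j - x 0 j| = s * \sum_j `|v 0 j|.
    rewrite mulr_sumr; apply: eq_bigr => j _.
    by rewrite !mxE [x 0 j + _]addrC addrK normrM gtr0_norm.
  by rewrite !mxE mulrCA.
have c_x : c s @[s --> 0^'+] --> x.
  apply: cvg_rV => k.
  have -> : (fun s => c s 0 k) = (fun s => x 0 k + s * v 0 k).
    by apply/funext => s; rewrite !mxE.
  suff : x 0 k + s * v 0 k @[s --> 0^'+] --> x 0 k + 0 * v 0 k.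
    by rewrite mul0r addr0.
  apply: cvgD; first exact: cvg_cst.
  apply: cvgM; last exact: cvg_cst.
  by apply: cvg_at_right_filter; exact: cvg_id.
have B_cvg : B s @[s --> 0^'+] -->
    \sum_k v 0 k * (ln (x 0 k) - ln (y x 0 k)) + mu * norm2 v ^+ 2 / eps.
  apply: cvgD.
    apply: cvg_sumr => k; apply: cvgM; first exact: cvg_cst.
    by apply: cvgB; [exact: cvg_ln|exact: cvg_cst].
  apply: cvgM; last exact: cvg_cst.
  rewrite -[X in _ --> X]addr0; apply: cvgD; first exact: cvg_cst.
  rewrite -[X in _ --> X](mulr0 (payoff_bound u * \sum_k `|v 0 k|)).
  apply: cvgM; first exact: cvg_cst.
  have w0 : \sum_k `|y x 0 k - x 0 k - v 0 k| = 0.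
    by apply: big1 => k _; rewrite !mxE subrr normr0.
  suff : \sum_k `|y (c s) 0 k - c s 0 k - v 0 k| @[s --> 0^'+] -->
      \sum_k `|y x 0 k - x 0 k - v 0 k| by rewrite w0.
  apply: cvg_sumr => k; apply: cvg_norm; apply: cvgB; last exact: cvg_cst.
  by apply: cvgB; apply: cvg_coord => //; exact: cvg_y.
have : 0 <= \sum_k v 0 k * (ln (x 0 k) - ln (y x 0 k)) +
    mu * norm2 v ^+ 2 / eps.
  apply: (cvgr_to_ge B_cvg); near=> s; apply: B_ge0.
  by apply/andP; split; near: s; [exact: nbhs_right_gt|exact: nbhs_right_le].
(* The limiting entropy slope is at most [- norm2 v ^+ 2], so the first-order condition becomes
   [0 <= (mu / eps - 1) * norm2 v ^+ 2], which forces [v = 0]. *)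
have := norm2_le_kl (yi x) ix.
have -> : \sum_k (y x 0 k - x 0 k) * (ln (y x 0 k) - ln (x 0 k)) =
    - \sum_k v 0 k * (ln (x 0 k) - ln (y x 0 k)).
  by rewrite -sumrN; apply: eq_bigr => k _; rewrite !mxE; ring.
rewrite -/v => v_le v_ge.
have : norm2 v ^+ 2 * (1 - mu / eps) <= 0.
  by rewrite mulrBr mulr1 mulrA [_ * mu]mulrC; lra.
rewrite pmulr_lle0 ?subr_gt0 ?ltr_pdivrMr ?mul1r//.
rewrite norm2_sqr => v0; apply/esym/rowP => k; apply/eqP.
have /psumr_eq0P : \sum_k v 0 k ^+ 2 = 0.
  by apply/eqP; rewrite eq_le v0 sumr_ge0// => j _; exact: sqr_ge0.
move=> /(_ (fun j _ => sqr_ge0 _) k isT)/eqP.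
by rewrite sqrf_eq0 !mxE subr_eq0.
Unshelve. all: by end_near.
Qed.

End Existence.

(** * Exponential decay for scalar differential inequalities *)

Section ExponentialDecay.
Variable R : realType.

(** The function [expR (k * t) * f t] is nonincreasing. The comparison starts at time 1 because
    two-sided derivatives are assumed only at positive times. *)
Lemma gronwall_decay (k : R) (f df : R -> R) :
  (forall t : R, 0 < t -> is_derive t 1 f (df t)) ->
  (forall t, 1 <= t -> df t <= - (k * f t)) ->
  forall t, 1 <= t -> f t <= expR k * f 1 * expR (- (k * t)).
Proof.
move=> fD df_le t t1.
pose g s := expR (k * s) * f s.
have gD (s : R) : 0 < s -> is_derive s 1 g (expR (k * s) * (df s + k * f s)).
  move=> s0; have fDs := fD _ s0.
  have eD : is_derive s 1 (fun r => expR (k * r)) (expR (k * s) * k).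
    apply: (is_derive1_comp (g := fun r => k * r)).
    by apply: is_derive_eq; rewrite [_%:A]mulr1.
  apply: is_derive_eq; rewrite /GRing.scale/=; ring.
have : g t <= g 1.
  apply: (ler0_derive1_nincry (a := 1)) => // [s|s|].
  - by rewrite in_itv/= andbT => s1; have [] := gD s (lt_trans ltr01 s1).
  - rewrite in_itv/= andbT => s1; have s0 := lt_trans ltr01 s1.
    have gDs := gD _ s0; rewrite derive1E derive_val.
    by rewrite pmulr_rle0 ?expR_gt0// -lerBrDr sub0r df_le// ltW.
  apply: derivable_within_continuous => s; rewrite in_itv/= andbT => s1.
  by have [] := gD s (lt_le_trans ltr01 s1).
rewrite /g mulr1 => g_le.
by rewrite expRN -ler_pdivrMr ?invr_gt0 ?expR_gt0// invrK mulrC.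
Qed.

Lemma cvg_expR_decay (k : R) : 0 < k ->
  expR (- (k * t)) @[t --> +oo] --> (0 : R).
Proof.
move=> k0.
have kt : t * k @[t --> +oo] --> +oo by exact: gt0_cvgMly.
under eq_fun do rewrite mulrC.
apply: (@cvg_comp _ _ _ (fun t => t * k) (fun x => expR (- x)) _ _ _ kt).
exact: cvgr_expR.
Qed.

(** With [D = C / (g - k)], [D * expR (- (k * t))] solves the equation with forcing
    [C * expR (- (k * t))]. Subtracting it from [w] leaves [f] with [f' <= - g f]. *)
Lemma linear_ode_le_decay (g k C : R) (w r : R -> R) : k < g ->
  (forall t : R, 0 < t -> is_derive t 1 w (g * (r t - w t))) ->
  (forall t, 1 <= t -> g * r t <= C * expR (- (k * t))) ->
  exists D E : R,
    forall t, 1 <= t -> w t <= D * expR (- (k * t)) + E * expR (- (g * t)).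
Proof.
move=> kg wD r_le; pose D := C / (g - k).
pose f t := w t - D * expR (- (k * t)).
have gk0 : g - k != 0 by rewrite subr_eq0 gt_eqF.
have fD (t : R) : 0 < t ->
    is_derive t 1 f (g * (r t - w t) + D * k * expR (- (k * t))).
  move=> t0; have wDt := wD _ t0.
  have eD : is_derive t 1 (fun s => expR (- (k * s))) (expR (- (k * t)) * - k).
    apply: (is_derive1_comp (g := fun s => - (k * s))).
    by apply: is_derive_eq; rewrite [_%:A]mulr1.
  by apply: is_derive_eq; rewrite /GRing.scale/=; ring.
have f_le t : 1 <= t ->
    g * (r t - w t) + D * k * expR (- (k * t)) <= - (g * f t).
  move=> t1; rewrite -subr_ge0.
  have -> : - (g * f t) - (g * (r t - w t) + D * k * expR (- (k * t))) =
      D * (g - k) * expR (- (k * t)) - g * r t by rewrite /f; ring.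
  by rewrite /D divfK// subr_ge0 r_le.
exists D, (expR g * f 1) => t t1; rewrite -lerBlDl.
exact: gronwall_decay fD f_le t t1.
Qed.

(** The upper bound [linear_ode_le_decay], applied to [w] and to [- w], squeezes [w] between
    decaying exponentials. *)
Lemma linear_ode_cvg0 (g k C : R) (w r : R -> R) : 0 < k -> k < g ->
  (forall t : R, 0 < t -> is_derive t 1 w (g * (r t - w t))) ->
  (forall t, 1 <= t -> `|r t| <= C * expR (- (k * t))) ->
  w t @[t --> +oo] --> (0 : R).
Proof.
move=> k0 kg wD r_le; have g0 := lt_trans k0 kg.
have [D [E w_le]] : exists D E : R,
    forall t, 1 <= t -> w t <= D * expR (- (k * t)) + E * expR (- (g * t)).
  apply: (linear_ode_le_decay (C := g * C) kg wD) => t t1.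
  by rewrite -mulrA ler_pM2l// (le_trans (ler_norm _))// r_le.
have [D' [E' w_ge]] : exists D E : R,
    forall t, 1 <= t -> (- w t) <= D * expR (- (k * t)) + E * expR (- (g * t)).
  apply: (linear_ode_le_decay (C := g * C) (w := fun t => - w t)
    (r := fun t => - r t) kg) => [t t0|t t1].
    by have wDt := wD _ t0; apply: is_derive_eq; ring.
  by rewrite -mulrA ler_pM2l// (le_trans (ler_norm _))// normrN r_le.
have cvg0 (a b : R) :
    a * expR (- (k * t)) + b * expR (- (g * t)) @[t --> +oo] --> (0 : R).
  rewrite -[X in _ --> X]addr0 -{1}[X in _ --> X + _](mulr0 a).
  rewrite -[X in _ --> _ + X](mulr0 b).
  by apply: cvgD; apply: cvgM; [exact: cvg_cst|exact: cvg_expR_decay|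
    exact: cvg_cst|exact: cvg_expR_decay].
apply: (squeeze_cvgr _ _ (cvg0 D E)); last first.
  by rewrite -[X in _ --> X]oppr0; apply: cvgN; exact: cvg0 D' E'.
near=> t; have t1 : 1 <= t by near: t; exact: nbhs_pinfty_ge.
by rewrite w_le// andbT lerNl w_ge.
Unshelve. all: by end_near.
Qed.

End ExponentialDecay.

(** * Convergence of the learning trajectories *)

Section Trajectories.
Variables (R : realType) (N : nat) (n : 'I_N -> nat).
Implicit Types (a : joint_vector R n) (z x : R -> joint_vector R n).

Lemma is_derive_sumr (I : finType) (h : I -> R -> R) (dh : I -> R) (t : R) :
  (forall i, is_derive t 1 (h i) (dh i)) ->
  is_derive t 1 (fun s => \sum_i h i s) (\sum_i dh i).
Proof.
move=> hD; elim: (index_enum I) => [|i r IH].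
  rewrite big_nil [X in is_derive _ _ X _](_ : _ = cst 0).
    exact: is_derive_cst.
  by apply/funext => s; rewrite big_nil.
rewrite big_cons.
rewrite [X in is_derive _ _ X _](_ : _ = h i + fun s => \sum_(j <- r) h j s).
  exact: is_deriveD.
by apply/funext => s; rewrite big_cons.
Qed.

(** At a positive time the constraint [0 <= t + h] holds for all small [h], so the restricted limit
    is an ordinary derivative. *)
Lemma exp_d_rl_is_derive (u : 'I_N -> action_profile n -> R) gamma eps z x
    (t : R) k :
  exp_d_rl u gamma eps z x -> 0 < t ->
  is_derive t 1 (fun s => z s 0 k) (gamma * (game_map u (x t) 0 k - z t 0 k)).
Proof.
move=> zx t0; have [zD _] := zx t (ltW t0).
have zD' : h^-1 *: (z (t + h) - z t) @[h --> 0^'] -->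
    gamma *: (game_map u (x t) - z t).
  move=> A /zD zA.
  have {}zA : \forall h \near 0^', 0 <= t + h -> A (h^-1 *: (z (t + h) - z t)).
    exact: zA.
  have t_gt : \forall h \near 0^', 0 <= t + h.
    apply: nbhs_dnbhs; have : - t < 0 by rewrite oppr_lt0.
    by move=> /lt_le_nbhsr; apply: filterS => h; rewrite -subr_ge0 opprK addrC.
  by apply: filterS2 t_gt zA => h t_h; apply.
have {}zD : h^-1 *: (z (h *: 1 + t) 0 k - z t 0 k) @[h --> 0^'] -->
    gamma * (game_map u (x t) 0 k - z t 0 k).
  have -> : gamma * (game_map u (x t) 0 k - z t 0 k) =
      (gamma *: (game_map u (x t) - z t)) 0 k by rewrite !mxE.
  have -> : (fun h => h^-1 *: (z (h *: 1 + t) 0 k - z t 0 k)) =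
      (fun h => (h^-1 *: (z (t + h) - z t)) 0 k).
    by apply/funext => h; rewrite !mxE [h%:A]mulr1 [h + t]addrC.
  exact: cvg_coord.
split; first exact: (cvgP _ zD).
exact: (cvg_lim _ zD).
Qed.

Hypothesis n_gt0 : forall p, (0 < n p)%N.

(** As a function of the scores the divergence is an affine map plus the log-partition functions,
    whose gradient is the soft-max divided by [eps]. *)
Lemma is_derive_kl_softmax eps a z dz (t : R) : mixed_profiles a ->
  (forall k, is_derive t 1 (fun s => z s 0 k) (dz k)) ->
  is_derive t 1 (fun s => kl a (joint_softmax eps (z s)))
    (\sum_k (joint_softmax eps (z t) 0 k - a 0 k) * (dz k / eps)).
Proof.
move=> ma zD.
have -> : (fun s => kl a (joint_softmax eps (z s))) = (fun s =>
    \sum_k a 0 k * (ln (a 0 k) - z s 0 k / eps) +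
    \sum_p ln (partition_function eps (z s) p)).
  apply/funext => s; rewrite -(mixed_sum_sig1 _ ma) -big_split/=.
  by apply: eq_bigr => k _; rewrite ln_joint_softmax//; ring.
have eD k : is_derive t 1 (fun s => expR (z s 0 k / eps))
    (expR (z t 0 k / eps) * (dz k / eps)).
  have zDk := zD k.
  apply: (is_derive1_comp (g := fun s => z s 0 k / eps)).
  by apply: is_derive_eq; rewrite /GRing.scale/=; ring.
have ZD p : is_derive t 1 (fun s => partition_function eps (z s) p)
    (\sum_(i < n p) expR (z t 0 (tagnat.Rank p i) / eps) *
       (dz (tagnat.Rank p i) / eps)).
  by apply: is_derive_sumr => i; exact: eD.
have lnD p : is_derive t 1 (fun s => ln (partition_function eps (z s) p))
    ((partition_function eps (z t) p)^-1 *
     \sum_(i < n p) expR (z t 0 (tagnat.Rank p i) / eps) *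
       (dz (tagnat.Rank p i) / eps)).
  apply: (is_derive1_comp (g := fun s => partition_function eps (z s) p)).
  exact/is_derive1_ln/partition_function_gt0.
have := is_derive_sumr lnD => sD.
have aD : is_derive t 1 (fun s => \sum_k a 0 k * (ln (a 0 k) - z s 0 k / eps))
    (\sum_k - (a 0 k * (dz k / eps))).
  apply: is_derive_sumr => k; have zDk := zD k.
  by apply: is_derive_eq; rewrite /GRing.scale/=; ring.
apply: is_derive_eq; rewrite addrC.
have -> : \sum_p (partition_function eps (z t) p)^-1 *
     (\sum_(i < n p) expR (z t 0 (tagnat.Rank p i) / eps) *
       (dz (tagnat.Rank p i) / eps)) =
   \sum_k joint_softmax eps (z t) 0 k * (dz k / eps).
  rewrite sum_joint; apply: eq_bigr => p _; rewrite mulr_sumr.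
  by apply: eq_bigr => i _; rewrite joint_softmaxE tagnat.Rank1K; ring.
by rewrite -big_split/=; apply: eq_bigr => k _; ring.
Qed.

Variables (u : 'I_N -> action_profile n -> R) (gamma eps mu : R).
Hypotheses (gamma_gt0 : 0 < gamma) (eps_gt0 : 0 < eps).
Hypotheses (mu_ge0 : 0 <= mu) (mu_lt_eps : mu < eps).
Hypothesis U_hypomonotone :
  hypomonotone_on mu (@mixed_profiles R N n) (fun y => - game_map u y).

Lemma kl_decay a z x : interior_profiles a ->
  a = joint_softmax eps (game_map u a) -> exp_d_rl u gamma eps z x ->
  exists2 C, 0 <= C & forall t, 1 <= t -> kl a (x t) <=
    C * expR (- (gamma * (1 - mu / eps) * t)).
Proof.
move=> ia aE zx; set k := gamma * (1 - mu / eps).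
pose V t := kl a (joint_softmax eps (z t)).
have xE t : 1 <= t -> x t = joint_softmax eps (z t).
  by move=> t1; have [] := zx t (le_trans ler01 t1).
have VD (t : R) : 0 < t -> is_derive t 1 V _ :=
  fun t0 => is_derive_kl_softmax eps ia.1 (fun k => exp_d_rl_is_derive k zx t0).
have V_le t : 1 <= t -> V t <= expR k * V 1 * expR (- (k * t)).
  apply: (gronwall_decay VD) => s s1; rewrite -xE// /V -xE//.
  have ix : interior_profiles (x s).
    by rewrite xE//; exact: joint_softmax_interior.
  (* Since [a] is the soft-max of [game_map u a], the symmetrised divergence of [x s] and [a] is a
     pairing of [x s - a] with scores; it is named [D] below. *)
  have xa := sum_sub_mul_ln_softmax n_gt0 eps (z s) (game_map u a) ix.1 ia.1.
  rewrite -aE -xE// in xa.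
  have a_le := kl_le ia ix.
  have n_le := norm2_le_kl ix ia; rewrite xa in n_le.
  have {}xa : \sum_j (a 0 j - x s 0 j) * (ln (a 0 j) - ln (x s 0 j)) =
      dot (x s - a) (z s - game_map u a) / eps.
    by rewrite -xa; apply: eq_bigr => j _; ring.
  rewrite xa in a_le; set D := _ / eps in a_le n_le xa.
  have := U_hypomonotone ix.1 ia.1.
  set E := dot _ (_ - _) => E_ge.
  (* Inserting [game_map u a] between [game_map u (x s)] and [z s] splits the derivative into a
     payoff part [E], controlled by hypo-monotonicity, and the dissipation [D]. *)
  have -> : \sum_j (x s 0 j - a 0 j) *
      (gamma * (game_map u (x s) 0 j - z s 0 j) / eps) =
      - (gamma / eps) * E - gamma * D.
    rewrite /E /D !dotE mulr_sumr mulr_suml mulr_sumr -sumrB.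
    by apply: eq_bigr => j _; rewrite !mxE; field; rewrite gt_eqF.
  have ge0 : 0 < gamma / eps by rewrite divr_gt0.
  have k0 : 0 <= k.
    by rewrite mulr_ge0 ?(ltW gamma_gt0)// subr_ge0 ler_pdivrMr// mul1r ltW.
  apply: (@le_trans _ _ (- (k * D))); last by rewrite lerN2 ler_wpM2l.
  have muE : - E <= mu * D.
    rewrite -[mu * D]opprK lerN2; apply: le_trans E_ge.
    by rewrite lerN2 ler_wpM2l.
  have := ler_wpM2l (ltW ge0) muE.
  have -> : gamma / eps * (mu * D) = gamma * D - k * D.
    by rewrite /k; field; rewrite gt_eqF.
  by rewrite mulrN mulNr; lra.
exists (expR k * V 1) => [|t t1].
  by rewrite mulr_ge0 ?expR_ge0// kl_ge0//; exact: joint_softmax_interior.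
by rewrite xE// V_le.
Qed.

Lemma exp_d_rl_converges z x : exp_d_rl u gamma eps z x ->
  converges_to_nash_distribution u eps z x.
Proof.
move=> zx.
have [a [ia aE]] :=
  nash_distribution_exists n_gt0 eps_gt0 mu_lt_eps U_hypomonotone.
have [C C0 kl_C] := kl_decay ia aE zx.
set k := gamma * (1 - mu / eps) in kl_C.
have mu1 : 0 < 1 - mu / eps by rewrite subr_gt0 ltr_pdivrMr// mul1r.
have k0 : 0 < k by rewrite mulr_gt0.
have kg : k <= gamma.
  by rewrite ler_piMr ?(ltW gamma_gt0)// gerBl divr_ge0// ltW.
have xi t : 1 <= t -> interior_profiles (x t).
  move=> t1; have [_ ->] := zx t (le_trans ler01 t1).
  exact: joint_softmax_interior.
have xa_le t j : 1 <= t -> `|x t 0 j - a 0 j| <= (1 + C) * expR (- (k / 2 * t)).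
  move=> t1; rewrite -ler_sqr ?nnegrE ?mulr_ge0 ?addr_ge0 ?expR_ge0//.
  rewrite exprMn -expRM_natr real_normK ?num_real//.
  have -> : - (k / 2 * t) * 2%:R = - (k * t) by field.
  have := le_trans (kl_ge_sqr ia (xi t t1)) (kl_C t t1).
  rewrite (bigD1 j)//= => h.
  have : (x t 0 j - a 0 j) ^+ 2 / 4 <= C * expR (- (k * t)).
    apply: le_trans h; rewrite -[X in X / 4]sqrrN opprB lerDl.
    by apply: sumr_ge0 => i _; rewrite divr_ge0 ?sqr_ge0.
  have := expR_gt0 (- (k * t)).
  (* The constant [1 + C] avoids a square root: the squared distance is at most [4 * C] times the
     exponential, and [4 * C <= (1 + C) ^+ 2]. *)
  have : 4 * C <= (1 + C) ^+ 2 by have := sqr_ge0 (1 - C); lra.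
  move=> h1 h2; have := ler_wpM2r (ltW h2) h1; lra.
have z_cvg : z t @[t --> +oo] --> game_map u a.
  apply: cvg_rV => j; rewrite -[X in _ --> X]add0r.
  have -> : (fun t => z t 0 j) =
      (fun t => (z t 0 j - game_map u a 0 j) + game_map u a 0 j).
    by apply/funext => t; rewrite subrK.
  apply: cvgD; last exact: cvg_cst.
  (* Taking the root has halved the rate, and [k / 2 < gamma] is strict even for [mu = 0], where
     [k = gamma]. The factor [\sum_p n p] in the constant counts the coordinates in the l1
     distance. *)
  apply: (linear_ode_cvg0 (g := gamma) (k := k / 2)
    (C := payoff_bound u * ((\sum_p n p)%N%:R * (1 + C)))
    (r := fun t => game_map u (x t) 0 j - game_map u a 0 j)).
  - by rewrite divr_gt0.
  - lra.
  - move=> t t0; have zD := exp_d_rl_is_derive j zx t0.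
    by apply: is_derive_eq; ring.
  move=> t t1.
  apply: le_trans (game_map_lipschitz u j (xi t t1).1 ia.1) _.
  rewrite -[leRHS]mulrA ler_wpM2l ?payoff_bound_ge0//.
  apply: le_trans (ler_sum _ (fun j _ => xa_le t j t1)) _.
  by rewrite sumr_const card_ord mulr_natl mulrnAl.
exists (game_map u a); rewrite -aE; split=> //.
  by split=> //; exact: ia.1.
have x_cvg : joint_softmax eps (z t) @[t --> +oo] --> a.
  by rewrite [X in _ --> X]aE; exact: cvg_joint_softmax.
apply: cvg_trans x_cvg.
apply: near_eq_cvg; near=> t.
have t0 : 0 <= t by near: t; exact: nbhs_pinfty_ge.
by have [_ ->] := zx t t0.
Unshelve. all: by end_near.
Qed.

End Trajectories.

Theorem theorem1 (R : realType) (N : nat) (n : 'I_N -> nat)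
    (n_gt0 : forall p, (0 < n p)%N)
    (u : 'I_N -> action_profile n -> R)
    (gamma eps : R) (gamma_gt0 : 0 < gamma) (eps_gt0 : 0 < eps)
    (fix_finite :
       finite_set (fixed_points (game_map u \o joint_softmax eps)))
    (fix_isolated :
       fixed_points (game_map u \o joint_softmax eps) `<=`
       isolated (fixed_points (game_map u \o joint_softmax eps))) :
  (monotone_on (@mixed_profiles R N n) (fun x => - game_map u x) ->
   forall z x : R -> joint_vector R n, exp_d_rl u gamma eps z x ->
   converges_to_nash_distribution u eps z x)
  /\
  (forall mu : R, 0 < mu ->
   hypomonotone_on mu (@mixed_profiles R N n) (fun x => - game_map u x) ->
   mu < eps ->
   forall z x : R -> joint_vector R n, exp_d_rl u gamma eps z x ->
   converges_to_nash_distribution u eps z x).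
Proof.
split=> [Umon z x|mu mu0 Umu mu_eps z x].
  apply: (exp_d_rl_converges n_gt0 gamma_gt0 eps_gt0 (lexx 0)) => //.
  move=> y y' my my'.
  by rewrite mul0r oppr0; exact: Umon.
exact: (exp_d_rl_converges n_gt0 gamma_gt0 eps_gt0 (ltW mu0) mu_eps Umu).
Qed.
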